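(* Let $H$ be a separable complex Hilbert space, let $K\in B(H)$ have closed range, and let $C\in GL^+(H)$ satisfy $CK=KC$. If a sequence $\{f_n\}_{n=1}^\infty\subset H$ is a $C$-controlled $K$-frame for $H$, then $\{f_n\}_{n=1}^\infty$ is a $K$-frame for $H$.
   Context: $B(H)$ denotes the bounded linear operators on $H$; $GL^+(H)$ denotes the set of positive bounded operators on $H$ that are invertible with bounded inverse (positive: $\langle Tf,f\rangle>0$ for all $f\neq 0$). The inner product is linear in the first variable. For $C\in GL^+(H)$, $C^{1/2}$ is its positive square root. A sequence $\{f_n\}_{n=1}^\infty\subset H$ is a $K$-frame for $H$ if there exist constants $A,B>0$ such that $A\|K^*f\|^2\le\sum_{n=1}^\infty|\langle f,f_n\rangle|^2\le B\|f\|^2$ for all $f\in H$. It is a $K$-Bessel sequence if the right-hand inequality holds for some $B>0$ (i.e. it is an ordinary Bessel sequence). For $C\in GL^+(H)$ with $CK=KC$, a sequence $\{f_n\}_{n=1}^\infty\subset H$ is a $C$-controlled $K$-frame for $H$ if it is a $K$-Bessel sequence and there exist constants $A>0$ and $B<\infty$ such that $$A\|C^{1/2}K^*f\|^2\le\sum_{n=1}^\infty\langle f,f_n\rangle\langle Cf_n,f\rangle\le B\|f\|^2\quad\text{for all } f\in H$$ (in particular the middle expression is real). *)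

(* Defs.v *)
From HB Require Import structures.
From mathcomp Require Import all_boot all_order all_algebra.
From mathcomp Require Import all_classical all_reals all_analysis.
From mathcomp Require Import complex.

Set Implicit Arguments.
Unset Strict Implicit.
Unset Printing Implicit Defensive.

Import Order.TTheory GRing.Theory Num.Theory.
Import numFieldNormedType.Exports.

Local Open Scope classical_set_scope.
Local Open Scope ring_scope.
Local Open Scope complex_scope.

(* Norms and inner products take values in R[i], whose order is
   [x <= y] iff ['Im x = 'Im y] and ['Re x <= 'Re y]: an inequality whose one
   side is real asserts in particular that the other side is real.
   [{dot H for Num.conj}] is linear in the first variable, conjugate linear in
   the second one, and positive definite. *)
HB.mixin Record CompleteNormedModule_hasInner (R : realType) H
    of CompleteNormedModule R[i] H := {
  inner : {dot H for (Num.conj : R[i] -> R[i])} ;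
  sqr_norm_inner : forall x : H, `|x| ^+ 2 = inner x x
}.

#[short(type="hilbertType")]
HB.structure Definition Hilbert (R : realType) :=
  {H of CompleteNormedModule R[i] H & CompleteNormedModule_hasInner R H}.

Notation "''[' x , y ]" := (inner x%R y%R) : ring_scope.

Definition separable_space (T : topologicalType) : Prop :=
  exists2 D : set T, countable D & dense D.

Section Operators.
Context {R : realType} {H : hilbertType R}.
Implicit Types T S : H -> H.

Definition bounded_op T : Prop :=
  linear T /\ exists M : R, forall x, `|T x| <= M%:C * `|x|.

Definition positive_op T : Prop := forall f, f != 0 -> 0 < '[T f, f].

Definition GLpos T : Prop :=
  [/\ bounded_op T, positive_op T &
      exists2 S, bounded_op S & cancel T S /\ cancel S T].

(* By Riesz representation and positive definiteness, exactly one [h]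
   qualifies when [T] is a bounded operator. *)
Definition adjoint T : H -> H :=
  fun g => get [set h | forall f, '[T f, g] = '[f, h]].

(* Exactly one [S] qualifies when [T] is in [GLpos]. *)
Definition sqrt_op T : H -> H :=
  get [set S | [/\ bounded_op S, positive_op S & S \o S = T]].

End Operators.

Section Frames.
Context {R : realType} {H : hilbertType R}.
Implicit Types K C : H -> H.

(* R[i] carries its topology under the alias [R[i]^o]. *)
Definition csum (u : nat -> R[i]) : R[i] := limn (series (u : nat -> R[i]^o)).

Definition csummable (u : nat -> R[i]) : Prop :=
  cvgn (series (u : nat -> R[i]^o)).

Definition frame_term (f_ : nat -> H) (f : H) (n : nat) : R[i] :=
  `|'[f, f_ n]| ^+ 2.

Definition controlled_term C (f_ : nat -> H) (f : H) (n : nat) : R[i] :=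
  '[f, f_ n] * '[C (f_ n), f].

Definition Bessel (f_ : nat -> H) : Prop :=
  exists2 B : R, 0 < B & forall f,
    csummable (frame_term f_ f) /\ csum (frame_term f_ f) <= B%:C * `|f| ^+ 2.

Definition K_frame K (f_ : nat -> H) : Prop :=
  exists A B : R, [/\ 0 < A, 0 < B & forall f,
    csummable (frame_term f_ f) /\
    A%:C * `|adjoint K f| ^+ 2 <= csum (frame_term f_ f) <= B%:C * `|f| ^+ 2].

Definition controlled_K_frame C K (f_ : nat -> H) : Prop :=
  Bessel f_ /\
  exists A B : R, 0 < A /\ forall f,
    csummable (controlled_term C f_ f) /\
    A%:C * `|sqrt_op C (adjoint K f)| ^+ 2
      <= csum (controlled_term C f_ f) <= B%:C * `|f| ^+ 2.

End Frames.

(* Main.v *)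
Require Import Defs.
From mathcomp Require Import all_boot all_order all_algebra.
From mathcomp Require Import all_classical all_reals all_analysis.
From mathcomp Require Import complex.
From mathcomp Require Import ring lra.
Import Order.TTheory GRing.Theory Num.Theory.
Import complex.
Import numFieldNormedType.Exports.
Local Open Scope classical_set_scope.
Local Open Scope ring_scope.

(** Let [S] be the frame operator of the Bessel sequence [f_]. Since [C] is
    self-adjoint, the controlled sum at [f] is [<S f, C f>]. It is real for
    every [f], so [C S] is self-adjoint, that is, [C] and [S] commute.
    Equivalently, [C] is symmetric for the semidefinite form
    [b f g = Re <S f, g>] ([csum_controlled], [polarization_sym]). Hence the
    bound [M] of [C] on [H] is also a bound of [C] for this form:
    [b f (C f) <= M * b f f] ([reid_inequality]). This follows from repeated use
    of Cauchy-Schwarz, since the moments [b (C ^ n f) f] are at most a constant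
    times [M ^ n].

    The lower bound of the controlled frame therefore gives
    [A * |C^(1/2) K^* f| ^ 2 <= M * b f f], where [b f f] is the frame sum at
    [f]. As [C] is bounded below and [C = C^(1/2) C^(1/2)] with [C^(1/2)]
    bounded, [C^(1/2)] is bounded below too, which turns the left-hand side into
    a multiple of [|K^* f| ^ 2].

    The only fact needed about [C^(1/2)] is that it exists
    ([GLpos_sqrt_exists]). A positive multiple of [C] is [1 - A] with [A]
    symmetric of norm less than [1], because [C] is bounded below and
    [|C x| ^ 2 <= M * <C x, x>] (Reid's inequality again, for the form
    [Re <C x, y>]); here [A] is an operator, no longer a frame bound. The
    iteration [Y := (A + Y ^ 2) / 2] from [0] then converges pointwise,
    geometrically, and [1] minus its limit is a square root of [1 - A]
    ([sqrt_one_minus]). *)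

(** * Semidefinite forms *)

Section Forms.
Context {R : realType} {V : lmodType R[i]}.
Implicit Types (b : V -> V -> R) (x y : V).

(** A real-valued, symmetric, real-bilinear, nonnegative form on a complex
    vector space: the real part of a positive semidefinite Hermitian form. *)
Definition psd_form b : Prop :=
  [/\ forall x y, b x y = b y x,
      forall x y z, b (x + y) z = b x z + b y z,
      forall (c : R) x y, b (c%:C%C *: x) y = c * b x y &
      forall x, 0 <= b x x].

Lemma cauchy_schwarz b x y : psd_form b -> b x y ^+ 2 <= b x x * b y y.
Proof.
case=> bC bD bZ b0.
(* [b] is nonnegative at [s x + t y]; then specialize [s] and [t] *)
have key (s t : R) :
    0 <= s ^+ 2 * b x x + 2 * (s * t) * b x y + t ^+ 2 * b y y.
  suff -> : s ^+ 2 * b x x + 2 * (s * t) * b x y + t ^+ 2 * b y y =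
            b (s%:C%C *: x + t%:C%C *: y) (s%:C%C *: x + t%:C%C *: y) by [].
  rewrite bD !bZ [b x (_ + _)]bC [b y (_ + _)]bC !bD !bZ [b y x]bC.
  by ring.
have [yy0|yy_neq0] := eqVneq (b y y) 0.
  have := key (b x y) (- (b x x + 1) / 2); rewrite yy0 !mulr0 addr0.
  by move: (b0 x); nra.
have yy_gt0 : 0 < b y y by rewrite lt_neqAle eq_sym yy_neq0 b0.
rewrite -subr_ge0 -(pmulr_rge0 _ yy_gt0).
suff -> : b y y * (b x x * b y y - b x y ^+ 2) =
  b y y ^+ 2 * b x x + 2 * (b y y * - b x y) * b x y + (- b x y) ^+ 2 * b y y.
  exact: key.
by ring.
Qed.

(** Reid's inequality: an operator that is symmetric for a semidefinite form [b]
    is bounded by [M] for [b] as soon as the moments [b (C ^ n x) x] grow no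
    faster than [M ^ n], even if they are only controlled by a constant [D]
    unrelated to [b x x]. *)
Lemma reid_inequality b (C : V -> V) x (D M : R) : psd_form b -> 0 < M ->
  (forall y z, b (C y) z = b y (C z)) ->
  (forall n, b (iter n C x) x <= D * M ^+ n) ->
  b (C x) x <= M * b x x.
Proof.
move=> bP M_gt0 symC bound; have [bC _ _ b0] := bP.
have iterC n y z : b (iter n C y) z = b y (iter n C z).
  by elim: n y z => //= n IH y z; rewrite symC IH -iterSr.
have [xx0|xx_neq0] := eqVneq (b x x) 0.
  by have := cauchy_schwarz b (C x) x bP; rewrite xx0; nra.
have xx_gt0 : 0 < b x x by rewrite lt_neqAle eq_sym xx_neq0 b0.
rewrite leNgt -ltr_pdivlMr //; apply/negP.
set r := b (C x) x / b x x => Mr.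
have r_gt0 : 0 < r by apply: lt_trans Mr.
(* Cauchy-Schwarz squares the ratio [r] when the moment doubles *)
have moments k : b x x * r ^+ (2 ^ k) <= b (iter (2 ^ k) C x) x.
  elim: k => [|k IH]; first by rewrite expn0 expr1 /r mulrC divfK.
  rewrite -(ler_pM2r xx_gt0).
  have := cauchy_schwarz b (iter (2 ^ k) C x) x bP.
  rewrite -[b (iter _ C x) (iter _ C x)]iterC -iterD addnn -mul2n -expnS.
  apply: le_trans.
  rewrite expnS mulnC exprM mulrAC -expr2 -exprMn.
  have r2k_ge0 : 0 <= b x x * r ^+ (2 ^ k).
    by rewrite mulr_ge0 ?exprn_ge0 // ltW.
  by rewrite [X in X <= _]mulrC ler_sqr ?nnegrE ?(le_trans _ IH).
(* so the powers of [r / M > 1] stay bounded, contradicting Bernoulli *)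
have ratio k : (r / M) ^+ (2 ^ k) <= D / b x x.
  rewrite expr_div_n ler_pdivrMr ?exprn_gt0 // mulrAC ler_pdivlMr // mulrC.
  exact: le_trans (moments k) (bound _).
have e_gt0 : 0 < r / M - 1 by rewrite subr_gt0 ltr_pdivlMr ?mul1r.
have [k hk] : exists k : nat, D / b x x < k%:R * (r / M - 1).
  exists (Num.bound `|D / b x x / (r / M - 1)|).
  by rewrite -ltr_pdivrMr // (le_lt_trans (ler_norm _)) // archi_boundP.
have := ratio k; apply/negP; rewrite -ltNge (lt_le_trans hk) //.
have bernoulli n : n%:R * (r / M - 1) <= (r / M) ^+ n - 1.
  elim: n => [|n IH]; first by rewrite mul0r expr0 subrr.
  have : 0 <= n%:R * (r / M - 1) by rewrite mulr_ge0 // ltW.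
  by rewrite exprS -natr1; nra.
apply: (@le_trans _ _ ((r / M) ^+ (2 ^ k) - 1)); last by rewrite gerBl.
by rewrite (le_trans _ (bernoulli _)) // ler_pM2r // ler_nat ltnW // ltn_expl.
Qed.

(** When [b] is the real part of a Hermitian form, [b ('i x) (C x)] is, up to
    sign, the imaginary part of that form at [x] and [C x]: an operator whose
    quadratic form is real is symmetric. *)
Lemma polarization_sym b (C : V -> V) : psd_form b ->
  (forall x y, b ('i%C *: x) y = - b x ('i%C *: y)) ->
  (forall x y, C (x + y) = C x + C y) ->
  (forall x, C ('i%C *: x) = 'i%C *: C x) ->
  (forall x, b ('i%C *: x) (C x) = 0) ->
  forall x y, b (C x) y = b x (C y).
Proof.
move=> [bC bD bZ _] bi CD Ci bC0 x y.
have ii (u : V) : 'i%C *: ('i%C *: u) = - u.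
  by rewrite scalerA -expr2 sqr_i scaleN1r.
have bDr (u v w : V) : b u (v + w) = b u v + b u w by rewrite bC bD !(bC u).
have bN (u v : V) : b (- u) v = - b u v.
  by have := bZ (-1) u v; rewrite rmorphN1 scaleN1r mulN1r.
(* expand the hypothesis at ['i x + y] *)
have := bC0 ('i%C *: x + y); have := bC0 x; have := bC0 y.
rewrite CD scalerDr ii bD !bDr !bN Ci => yy xx.
rewrite -(bi x) xx yy add0r addr0 bi ii [b y _]bC bN opprK [b _ y]bC.
by rewrite addrC => /eqP; rewrite subr_eq0 => /eqP.
Qed.

End Forms.

(** * Real inner product and norm; operators *)

Section Inner.
Context {R : realType} {H : hilbertType R}.
Implicit Types (x y z : H) (a : R[i]).

(** The inner product and the norm of [H] with values in [R] rather than in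
    [R[i]]. *)
Definition rdot x y : R := complex.Re '[x, y].
Definition rnorm x : R := complex.Re `|x|.

Lemma innerC x y : '[x, y] = ('[y, x])^*%C.
Proof. by rewrite hermC expr0 mul1r. Qed.

Lemma innerDl x y z : '[x + y, z] = '[x, z] + '[y, z].
Proof. by rewrite linearDl. Qed.

Lemma innerZl a x z : '[a *: x, z] = a * '[x, z].
Proof. by rewrite linearZl_LR. Qed.

Lemma innerDr x y z : '[z, x + y] = '[z, x] + '[z, y].
Proof. by rewrite linearDr. Qed.

Lemma innerZr a x z : '[z, a *: x] = a^*%C * '[z, x].
Proof. by rewrite linearZr. Qed.

Lemma innerNl x z : '[- x, z] = - '[x, z].
Proof. by rewrite linearNl. Qed.

Lemma innerNr x z : '[z, - x] = - '[z, x].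
Proof. by rewrite linearNr. Qed.

Lemma norm_rnorm x : `|x| = (rnorm x)%:C%C.
Proof. by rewrite RRe_real // ger0_real. Qed.

Lemma rnorm_ge0 x : 0 <= rnorm x.
Proof. by rewrite -ler0c -norm_rnorm. Qed.

Lemma inner_rnorm x : '[x, x] = (rnorm x ^+ 2)%:C%C.
Proof. by rewrite -sqr_norm_inner norm_rnorm rmorphXn. Qed.

Lemma rdotxx x : rdot x x = rnorm x ^+ 2.
Proof. by rewrite /rdot inner_rnorm. Qed.

Lemma rdot_psd : psd_form rdot.
Proof.
split=> [x y|x y z|c x y|x]; last by rewrite rdotxx sqr_ge0.
- by rewrite /rdot innerC; case: '[y, x].
- by rewrite /rdot innerDl raddfD.
- by rewrite /rdot innerZl; case: '[x, y] => u v /=; rewrite mul0r subr0.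
Qed.

Lemma rdot_i x y : rdot ('i%C *: x) y = - rdot x ('i%C *: y).
Proof.
by rewrite /rdot innerZl innerZr; case: '[x, y] => u v /=; ring.
Qed.

Lemma rnormD x y : rnorm (x + y) <= rnorm x + rnorm y.
Proof. by have := ler_normD x y; rewrite !norm_rnorm -rmorphD lecR. Qed.

Lemma rnormN x : rnorm (- x) = rnorm x.
Proof. by rewrite /rnorm normrN. Qed.

Lemma rnorm0 : rnorm 0 = 0.
Proof. by rewrite /rnorm normr0. Qed.

Lemma rnormZ (c : R) x : 0 <= c -> rnorm (c%:C%C *: x) = c * rnorm x.
Proof.
move=> c0; apply: complexI; rewrite -norm_rnorm normrZ rmorphM /= norm_rnorm.
by rewrite ger0_norm ?ler0c.
Qed.

Lemma rnorm_eq0 x : rnorm x = 0 -> x = 0.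
Proof. by move=> h; apply/eqP; rewrite -normr_eq0 norm_rnorm h. Qed.

Lemma rdot_le x y : rdot x y <= rnorm x * rnorm y.
Proof.
have := cauchy_schwarz rdot x y rdot_psd; rewrite !rdotxx -exprMn => h.
apply: le_trans (ler_norm _) _.
by rewrite -ler_sqr ?nnegrE ?mulr_ge0 ?rnorm_ge0 // real_normK ?num_real.
Qed.

Lemma Im_inner x y : Im '[x, y] = - rdot ('i%C *: x) y.
Proof. by rewrite /rdot innerZl mulrC ReiNIm opprK. Qed.

Lemma Im_inner_le x y : `|Im '[x, y]| <= rnorm x * rnorm y.
Proof.
have inorm : rnorm ('i%C *: x) = rnorm x.
  rewrite /rnorm normrZ; congr (Re _).
  by rewrite [`|'i%C|]normc_def /= expr0n expr1n add0r sqrtr1 mul1r.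
have := rdot_le ('i%C *: x) y; have := rdot_le (- ('i%C *: x)) y.
rewrite rnormN inorm {1}/rdot -scaleN1r innerZl mulN1r raddfN /= -/(rdot _ _).
by rewrite Im_inner normrN ler_norml => h1 h2; apply/andP; split; lra.
Qed.

End Inner.

Section Ops.
Context {R : realType} {H : hilbertType R}.
Implicit Types (x y z : H) (T : H -> H).

Lemma linear_opE T : linear T ->
  [/\ forall x y, T (x + y) = T x + T y, forall x y, T (x - y) = T x - T y,
   T 0 = 0 & forall (c : R[i]) x, T (c *: x) = c *: T x].
Proof.
move=> lT; have TD x y : T (x + y) = T x + T y.
  by have := lT 1 x y; rewrite !scale1r.
have T0 : T 0 = 0 by apply: (@addrI _ (T 0)); rewrite -TD !addr0.
have TZ (c : R[i]) x : T (c *: x) = c *: T x.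
  by have := lT c x 0; rewrite !addr0 T0 addr0.
by split => // x y; rewrite TD -scaleN1r TZ scaleN1r.
Qed.

(** The bound of a bounded operator can be taken positive. *)
Lemma bounded_op_rnorm T : bounded_op T ->
  exists2 M : R, 0 < M & forall x, rnorm (T x) <= M * rnorm x.
Proof.
case=> _ [M hM]; exists (`|M| + 1); first by rewrite ltr_wpDl.
move=> x; have := hM x; rewrite !norm_rnorm -rmorphM lecR => /le_trans; apply.
rewrite ler_wpM2r ?rnorm_ge0 //.
by rewrite (le_trans (ler_norm _)) // lerDl.
Qed.

End Ops.

(** * Limits *)

Section Csum.
Context {R : realType}.
Implicit Types (u : nat -> R[i]).

(** A constant dominated by a null sequence is nonpositive. *)
Lemma le0_of_cvg0 (d : nat -> R) (k c : R) :
  d @ \oo --> (0 : R) -> (forall n, k <= c * d n) -> k <= 0.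
Proof.
move=> d0 hk; rewrite -(mulr0 c).
have cd : (fun n => c * d n) @ \oo --> c * 0.
  by apply: cvgM => //; exact: cvg_cst.
rewrite -(cvg_lim _ cd) //; apply: limr_ge.
  by apply/cvg_ex; exists (c * 0).
exact: nearW.
Qed.

Lemma normRe_lt (z : R[i]) (e : R) : `|z| < e%:C%C -> `|Re z| < e.
Proof. by move=> h; rewrite -ltcR (le_lt_trans (normc_ge_Re z)). Qed.

Lemma normIm_lt (z : R[i]) (e : R) : `|z| < e%:C%C -> `|Im z| < e.
Proof.
move=> h; rewrite -ltcR; apply: le_lt_trans h.
have := normc_ge_Re (z * 'i%C); rewrite ReiNIm normrM normrN.
by rewrite [`|'i%C|]normc_def /= expr0n expr1n add0r sqrtr1 mulr1.
Qed.

Lemma cvg_ReIm (u : nat -> R[i]^o) (l : R[i]^o) : u @ \oo --> l ->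
  (fun n => Re (u n)) @ \oo --> Re l /\ (fun n => Im (u n)) @ \oo --> Im l.
Proof.
move=> /cvgrPdist_lt ul; split; apply/cvgrPdist_lt => e e0.
  have /ul : 0 < e%:C%C :> R[i] by rewrite (ltcR 0 e).
  by apply: filterS => n /normRe_lt; rewrite raddfB.
have /ul : 0 < e%:C%C :> R[i] by rewrite (ltcR 0 e).
by apply: filterS => n /normIm_lt; rewrite raddfB.
Qed.

Lemma csum_ReIm u : csummable u ->
  series (fun n => Re (u n)) @ \oo --> Re (csum u) /\
  series (fun n => Im (u n)) @ \oo --> Im (csum u).
Proof.
move=> /cvg_ReIm [hRe hIm]; split.
  rewrite (_ : series _ = fun n => Re (series (u : nat -> R[i]^o) n)) //.
  by apply/funext => n; rewrite /series /= raddf_sum.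
rewrite (_ : series _ = fun n => Im (series (u : nat -> R[i]^o) n)) //.
by apply/funext => n; rewrite /series /= raddf_sum.
Qed.

End Csum.

(** * Square roots *)

Section SquareRoot.
Context {R : realType} {H : hilbertType R}.
Implicit Types (x y z : H) (A : H -> H).

Lemma rnorm_cvg (u : nat -> H) (l : H) : u @ \oo --> l ->
  (fun n => rnorm (u n - l)) @ \oo --> (0 : R).
Proof.
move=> /cvgrPdist_lt ul; apply/cvgrPdist_lt => e e0.
have /ul : 0 < e%:C%C :> R[i] by rewrite (ltcR 0 e).
apply: filterS => n; rewrite norm_rnorm ltcR => h.
by rewrite sub0r normrN ger0_norm ?rnorm_ge0 // -rnormN opprB.
Qed.

(** The iteration [Y 0 = 0], [Y n.+1 = (A + Y n ^ 2) / 2], whose limit [Y]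
    satisfies [(1 - Y) ^ 2 = 1 - A] when the norm of [A] is less than [1]. *)
Fixpoint sqrt_iter A n x : H :=
  if n is m.+1 then (2^-1 : R)%:C%C *: (A x + sqrt_iter A m (sqrt_iter A m x))
  else 0.

(** Increments dominated by a geometric sequence of ratio less than [1] force
    convergence, by completeness of [H]. *)
Lemma geometric_cvg (u : nat -> H) (a c : R) : 0 <= a < 1 ->
  (forall n, rnorm (u n.+1 - u n) <= c * a ^+ n) -> cvgn u.
Proof.
move=> /andP[a0 a1] hu.
have geo : cvgn (series (geometric c a)).
  by apply: is_cvg_geometric_series; rewrite ger0_norm.
have : cvgn (series (telescope u)).
  apply/cauchy_cvgP/cauchy_seriesP => e e0.
  have eE : e = (Re e)%:C%C by rewrite RRe_real // gtr0_real.
  have Re0 : 0 < Re e by rewrite -ltcR -eE.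
  have /cauchy_cvgP/cauchy_seriesP/(_ _ Re0) := geo.
  apply: filterS => -[m n] /= h.
  rewrite eE; apply: le_lt_trans (ler_norm_sum _ _ _) _.
  apply: (@le_lt_trans _ _ (\sum_(m <= k < n) (c * a ^+ k)%:C%C)).
    by apply: ler_sum => k _; rewrite norm_rnorm lecR; exact: hu.
  rewrite -rmorph_sum ltcR; apply: le_lt_trans (ler_norm _) h.
rewrite telescopeK => cv; rewrite (_ : u = (fun n => (u n - u 0%N) + u 0%N)).
  by apply: is_cvgD => //; exact: is_cvg_cst.
by apply/funext => n; rewrite subrK.
Qed.

Section Iter.
Variables (A : H -> H) (a : R).
Hypotheses (linA : linear A) (a_ge0 : 0 <= a) (a_lt1 : a < 1).
Hypothesis A_le : forall x, rnorm (A x) <= a * rnorm x.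
Local Notation Y := (sqrt_iter A).

Lemma sqrt_iter_linear n : linear (Y n).
Proof.
elim: n => [|n IH] c x y /=; first by rewrite scaler0 addr0.
by rewrite linA !IH addrACA -scalerDr [LHS]scalerDr !scalerA [in LHS]mulrC.
Qed.

Lemma sqrt_iter_le n x : rnorm (Y n x) <= a * rnorm x.
Proof.
elim: n x => [|n IH] x /=; first by rewrite rnorm0 mulr_ge0 ?rnorm_ge0.
rewrite rnormZ ?invr_ge0 // ler_pdivrMl //.
apply: le_trans (rnormD _ _) _.
have h1 := A_le x; have h2 := IH (Y n x); have h3 := IH x.
have h4 : a * rnorm (Y n x) <= rnorm (Y n x).
  by rewrite ler_piMl ?rnorm_ge0 // ltW.
by lra.
Qed.

Lemma sqrt_iter_comm (B : H -> H) n x :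
  linear B -> (forall x, B (A x) = A (B x)) -> B (Y n x) = Y n (B x).
Proof.
move=> /linear_opE[BD _ B0 BZ] BA; elim: n x => [|n IH] x //=.
by rewrite BZ BD BA !IH.
Qed.

Lemma sqrt_iter_diff n x : rnorm (Y n.+1 x - Y n x) <= rnorm x * a ^+ n.
Proof.
elim: n x => [|n IH] x.
  rewrite expr0 mulr1 subr0.
  apply: le_trans (sqrt_iter_le _ _) _.
  by rewrite ler_piMl ?rnorm_ge0 ?ltW.
(* [Y n] commutes with [Y n.+1], so the difference of squares factors *)
set d := Y n.+1 x - Y n x.
have YA m y : Y m (A y) = A (Y m y) by rewrite -sqrt_iter_comm.
have YY : Y n.+1 (Y n x) = Y n (Y n.+1 x).
  by apply: sqrt_iter_comm => //; exact: sqrt_iter_linear.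
have -> : Y n.+2 x - Y n.+1 x = (2^-1 : R)%:C%C *: (Y n.+1 d + Y n d).
  have [_ B1 _ _] := linear_opE _ (sqrt_iter_linear n.+1).
  have [_ B2 _ _] := linear_opE _ (sqrt_iter_linear n).
  rewrite /d B1 B2 YY addrA subrK -[LHS]scalerBr.
  by congr (_ *: _); rewrite opprD addrACA subrr add0r.
rewrite rnormZ ?invr_ge0 // ler_pdivrMl //.
apply: le_trans (rnormD _ _) _.
have := sqrt_iter_le n.+1 d; have := sqrt_iter_le n d.
have : a * rnorm d <= a * (rnorm x * a ^+ n) by rewrite ler_wpM2l // IH.
by rewrite exprS mulrCA; lra.
Qed.

Lemma sqrt_iter_sym n x y : (forall x y, '[A x, y] = '[x, A y]) ->
  '[Y n x, y] = '[x, Y n y].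
Proof.
move=> symA; elim: n x y => [|n IH] x y /=; first by rewrite linear0l linear0r.
rewrite innerZl innerZr conjc_real innerDl innerDr symA.
by rewrite !IH.
Qed.

(** A symmetric contraction [A] of ratio [a < 1] gives a positive square root of
    [1 - A]. *)
Lemma sqrt_one_minus : (forall x y, '[A x, y] = '[x, A y]) ->
  exists Q : H -> H,
    [/\ bounded_op Q, positive_op Q & forall x, Q (Q x) = x - A x].
Proof.
move=> symA.
have Ycvg x : cvgn (fun n => Y n x).
  apply: (@geometric_cvg _ a (rnorm x)); first by rewrite a_ge0.
  by move=> n; exact: sqrt_iter_diff.
pose L x := limn (fun n => Y n x).
have YL x : (fun n => Y n x) @ \oo --> L x by exact: Ycvg.
have YLn x := rnorm_cvg _ _ (YL x).
have linL : linear L.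
  move=> c x y; rewrite /L; apply: cvg_lim => //.
  rewrite (_ : (fun n => _) = fun n => c *: Y n x + Y n y).
    by apply: cvgD; [apply: cvgZr; exact: YL|exact: YL].
  by apply/funext => n; rewrite sqrt_iter_linear.
have L_le x : rnorm (L x) <= a * rnorm x.
  rewrite -subr_le0; apply: (@le0_of_cvg0 _ _ _ 1 (YLn x)) => n.
  rewrite mul1r lerBlDr; have := sqrt_iter_le n x.
  have := rnormD (L x - Y n x) (Y n x); rewrite subrK -(rnormN (L x - _)) opprB.
  by lra.
have [LD LB _ LZ] := linear_opE _ linL.
(* pass to the limit in the recursion *)
have Lfix x : L x = (2^-1 : R)%:C%C *: (A x + L (L x)).
  apply/eqP; rewrite -subr_eq0; apply/eqP/rnorm_eq0/le_anti.
  rewrite rnorm_ge0 andbT.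
  pose d n := rnorm (Y n.+1 x - L x) + (rnorm (Y n x - L x)
    + rnorm (Y n (L x) - L (L x))).
  have d0 : d @ \oo --> (0 : R).
    rewrite -[0 in X in _ --> X](addr0 (0 : R)).
    apply: cvgD; first by have := YLn x; rewrite -cvg_shiftS.
    rewrite -[0 in X in _ --> X](addr0 (0 : R)).
    by apply: cvgD; exact: YLn.
  apply: (@le0_of_cvg0 _ _ _ 1 d0) => n; rewrite mul1r /d.
  have -> : L x - (2^-1 : R)%:C%C *: (A x + L (L x)) = - (Y n.+1 x - L x)
      + (2^-1 : R)%:C%C *: (Y n (Y n x - L x) + (Y n (L x) - L (L x))).
    have [_ YB _ _] := linear_opE _ (sqrt_iter_linear n).
    rewrite YB addrA subrK opprB -addrA; congr (_ + _).
    rewrite -[Y n.+1 x]/((2^-1 : R)%:C%C *: (A x + Y n (Y n x))).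
    rewrite -!scalerN -scalerDr; congr (_ *: _).
    by rewrite addrA [in RHS]opprD subrK opprD.
  apply: le_trans (rnormD _ _) _; rewrite rnormN lerD2l rnormZ ?invr_ge0 //.
  rewrite ler_pdivrMl //; apply: le_trans (rnormD _ _) _.
  have := sqrt_iter_le n (Y n x - L x).
  have : a * rnorm (Y n x - L x) <= rnorm (Y n x - L x).
    by rewrite ler_piMl ?rnorm_ge0 // ltW.
  have := rnorm_ge0 (Y n x - L x).
  by have := rnorm_ge0 (Y n (L x) - L (L x)); lra.
(* ['[Y n x, x]] is real because [Y n] is symmetric *)
have L_real x : Im '[L x, x] = 0.
  apply/eqP; rewrite -normr_le0; apply: (@le0_of_cvg0 _ _ _ (rnorm x) (YLn x)).
  move=> n; suff -> : Im '[L x, x] = Im '[L x - Y n x, x].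
    by rewrite mulrC -(rnormN (Y n x - _)) opprB Im_inner_le.
  rewrite innerDl raddfD /= -[in '[- _, _]]scaleN1r innerZl mulN1r raddfN /=.
  suff -> : Im '[Y n x, x] = 0 by rewrite subr0.
  have := innerC (Y n x) x; rewrite -sqrt_iter_sym //.
  by case: '[Y n x, x] => u v [] /=; lra.
exists (fun x => x - L x); split.
- split; first by move=> c x y; rewrite linL scalerBr opprD addrACA.
  exists (1 + a) => x; rewrite !norm_rnorm -rmorphM lecR mulrDl mul1r.
  by apply: le_trans (rnormD _ _) _; rewrite rnormN lerD2l.
- move=> x x_neq0.
  rewrite innerDl -scaleN1r innerZl mulN1r inner_rnorm ltcE !raddfB /=.
  rewrite L_real subrr eqxx /= subr_gt0; apply: le_lt_trans (rdot_le _ _) _.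
  have x_gt0 : 0 < rnorm x.
    rewrite lt_neqAle rnorm_ge0 andbT eq_sym.
    by apply: contra x_neq0 => /eqP/rnorm_eq0/eqP.
  rewrite expr2 ltr_pM2r //; apply: le_lt_trans (L_le _) _.
  by rewrite gtr_pMl.
- move=> x; rewrite LB.
  have L2 : L x + L x = A x + L (L x).
    rewrite {1 2}Lfix -scalerDl -rmorphD /= (_ : _ + _ = 1) ?scale1r //.
    by rewrite -div1r -splitr.
  have -> : L (L x) = L x + L x - A x by rewrite L2 addrAC subrr add0r.
  have -> : L x - (L x + L x - A x) = A x - L x.
    by rewrite -addrA opprD addrA subrr sub0r opprB.
  by rewrite opprB addrA subrK.
Qed.

End Iter.
End SquareRoot.

Section GLpos.
Context {R : realType} {H : hilbertType R}.
Implicit Types (x y z : H) (C : H -> H).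

(** Bounded positive operators on a complex Hilbert space are self-adjoint. *)
Lemma positive_sym C : bounded_op C -> positive_op C ->
  forall x y, '[C x, y] = '[x, C y].
Proof.
case=> /linear_opE[CD _ C0 CZ] _ Cpos.
have Creal x : Im '[C x, x] = 0.
  have [->|x0] := eqVneq x 0; first by rewrite C0 linear0l.
  by have := Cpos _ x0; rewrite ltcE => /andP[/eqP].
have rsym : forall x y, rdot (C x) y = rdot x (C y).
  apply: polarization_sym => //; [exact: rdot_psd|exact: rdot_i|].
  move=> x; rewrite /rdot innerZl mulrC ReiNIm innerC.
  by have := Creal x; case: '[C x, x] => u v /= ->; rewrite !oppr0.
move=> x y; apply/eqP; rewrite eq_complex !Im_inner -CZ rsym -!/(rdot _ _) rsym.
by rewrite !eqxx.
Qed.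

Lemma rnorm_iter_le C (M : R) n x : 0 <= M ->
  (forall x, rnorm (C x) <= M * rnorm x) ->
  rnorm (iter n C x) <= M ^+ n * rnorm x.
Proof.
move=> M0 hM; elim: n => [|n IH] /=; first by rewrite mul1r.
by apply: le_trans (hM _) _; rewrite exprS -mulrA ler_wpM2l.
Qed.

(** This is Reid's inequality for the form [(u, v) |-> rdot (C u) v]. *)
Lemma sqr_rnorm_le C (M : R) : bounded_op C -> positive_op C -> 0 < M ->
  (forall x, rnorm (C x) <= M * rnorm x) ->
  forall x, rnorm (C x) ^+ 2 <= M * rdot (C x) x.
Proof.
move=> Cb Cpos M0 hM x; have symC := positive_sym C Cb Cpos.
have [CD _ C0 CZ] := linear_opE _ (proj1 Cb).
have [rC rD rZ r0] := @rdot_psd R H.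
have rsym u v : rdot (C u) v = rdot u (C v) by rewrite /rdot symC.
rewrite -rdotxx -rsym.
pose b u v := rdot (C u) v.
apply: (@reid_inequality _ _ b C x (M * rnorm x ^+ 2)); rewrite /b //.
- split=> [u v|u v w|c u v|u]; rewrite ?rsym //.
  + by rewrite rC.
  + have [->|u0] := eqVneq u 0; first by rewrite C0 rdotxx sqr_ge0.
    by have := Cpos _ u0; rewrite ltcE -rsym => /andP[_ /ltW].
- move=> n; rewrite -iterS; apply: le_trans (rdot_le _ _) _.
  have := rnorm_iter_le C M n.+1 x (ltW M0) hM.
  move/(ler_wpM2r (rnorm_ge0 x)) => /le_trans; apply.
  by rewrite exprS le_eqVlt; apply/orP; left; apply/eqP; ring.
Qed.

(** With [M] a bound of [C] and [m] a bound of its inverse, [A = 1 - M^-1 C]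
    satisfies [|A x| ^ 2 <= (1 - (M m) ^ -2) |x| ^ 2]; the square root of [C] is
    then [sqrt M] times that of [1 - A]. *)
Lemma GLpos_sqrt_exists C : GLpos C ->
  exists S : H -> H, [/\ bounded_op S, positive_op S & S \o S = C].
Proof.
case=> Cb Cpos [D Db [CK DK]].
have [M M_gt0 hM] := bounded_op_rnorm _ Cb.
have [m m_gt0 hm] := bounded_op_rnorm _ Db.
have lower x : rnorm x <= m * rnorm (C x) by rewrite -{1}(CK x).
have [CD CB C0 CZ] := linear_opE _ (proj1 Cb).
pose A x : H := x - (M^-1)%:C%C *: C x.
pose t := 1 - (M * m) ^- 2; pose a := Num.sqrt t.
(* [t < 0] is possible when [H] is trivial; the square root [a] is then [0] *)
have t_le : t <= a ^+ 2.
  have [t0|t0] := leP 0 t; first by rewrite sqr_sqrtr.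
  by rewrite (le_trans (ltW t0)) // sqr_ge0.
have symC := positive_sym C Cb Cpos.
have [rC rD rZ r0] := @rdot_psd R H.
have linA : linear A.
  move=> c x y; rewrite /A CD CZ scalerDr scalerBr opprD addrACA.
  by rewrite !scalerA mulrC.
(* in the square of [x - M^-1 C x], the cross term outweighs twice the last
   one by [sqr_rnorm_le] *)
have A_le x : rnorm (A x) <= a * rnorm x.
  rewrite -ler_sqr ?nnegrE ?mulr_ge0 ?rnorm_ge0 ?sqrtr_ge0 //.
  rewrite exprMn; apply: (@le_trans _ _ (t * rnorm x ^+ 2)); last first.
    by rewrite ler_wpM2r // sqr_ge0.
  have -> : rnorm (A x) ^+ 2 = rnorm x ^+ 2 - 2 * M^-1 * rdot (C x) x
      + M^-1 ^+ 2 * rnorm (C x) ^+ 2.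
    rewrite -!rdotxx /A -scaleNr -rmorphN rD !rZ ![rdot _ (_ + _)]rC !rD !rZ.
    by rewrite [rdot x (C x)]rC; ring.
  have h1 := sqr_rnorm_le C M Cb Cpos M_gt0 hM x.
  have h2 : rnorm x ^+ 2 <= m ^+ 2 * rnorm (C x) ^+ 2.
    by rewrite -exprMn ler_sqr ?nnegrE ?mulr_ge0 ?rnorm_ge0 // ltW.
  have h3 : M^-1 ^+ 2 * rnorm (C x) ^+ 2 <= M^-1 * rdot (C x) x.
    by rewrite expr2 -mulrA ler_pM2l ?invr_gt0 // ler_pdivrMl.
  have h4 : (M * m) ^- 2 * rnorm x ^+ 2 <= M^-1 ^+ 2 * rnorm (C x) ^+ 2.
    rewrite exprMn invfM -mulrA -exprVn ler_pM2l ?exprn_gt0 ?invr_gt0 //.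
    by rewrite ler_pdivrMl ?exprn_gt0.
  by rewrite /t mulrBl mul1r; lra.
have a_lt1 : a < 1.
  rewrite -sqrtr1 ltr_sqrt // /t gtrBl invr_gt0 exprn_gt0 //.
  by rewrite mulr_gt0.
have symA x y : '[A x, y] = '[x, A y].
  rewrite /A !innerDr !innerDl innerNl innerNr innerZl innerZr conjc_real.
  by rewrite symC.
have [Q [Qb Qpos QQ]] := sqrt_one_minus A a linA (sqrtr_ge0 _) a_lt1 A_le symA.
have [QD QB Q0 QZ] := linear_opE _ (proj1 Qb).
have sM : 0 < Num.sqrt M by rewrite sqrtr_gt0.
exists (fun x => (Num.sqrt M)%:C%C *: Q x); split.
- split; first by move=> c x y; rewrite QD QZ scalerDr !scalerA mulrC.
  have [N _ hN] := bounded_op_rnorm _ Qb; exists (Num.sqrt M * N) => x.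
  by rewrite !norm_rnorm -rmorphM lecR rnormZ ?(ltW sM) // -mulrA ler_pM2l.
- by move=> x x0; rewrite innerZl mulr_gt0 ?Qpos // (ltcR 0).
- apply/funext => x /=; rewrite QZ scalerA QQ /A opprB addrC subrK scalerA.
  rewrite -!rmorphM /= -expr2 sqr_sqrtr ?(ltW M_gt0) // mulfV ?scale1r //.
  by rewrite gt_eqF.
Qed.

End GLpos.

(** * The frame form *)

Section FrameForm.
Context {R : realType} {H : hilbertType R}.
Variable f_ : nat -> H.
Implicit Types f g h : H.

Definition frame_form_term f g : R ^nat :=
  fun n => Re ('[f, f_ n] * '[f_ n, g]).

(** The form [(f, g) |-> Re <S f, g>], where [S] is the frame operator of the
    sequence [f_]; using the form avoids constructing [S] itself. *)
Definition frame_form f g : R := limn (series (frame_form_term f g)).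

Lemma frame_termE f n : frame_term f_ f n = (frame_form_term f f n)%:C%C.
Proof.
rewrite /frame_term /frame_form_term [in RHS](innerC (f_ n) f) -sqr_normc.
by rewrite -add_Re2_Im2.
Qed.

Lemma Re_frame_term f : (fun n => Re (frame_term f_ f n)) = frame_form_term f f.
Proof. by apply/funext => n; rewrite frame_termE. Qed.

Lemma frame_form_termC f g : frame_form_term f g = frame_form_term g f.
Proof.
apply/funext => n; rewrite /frame_form_term (innerC f) (innerC _ g).
by case: '[f_ n, f] => a b; case: '[g, f_ n] => c d /=; ring.
Qed.

Lemma frame_form_termD f g h :
  frame_form_term (f + g) h = frame_form_term f h + frame_form_term g h.
Proof.
by apply/funext => n; rewrite /frame_form_term innerDl mulrDl raddfD.
Qed.

Lemma frame_form_termZ (c : R) f g :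
  frame_form_term (c%:C%C *: f) g = c *: frame_form_term f g.
Proof.
apply/funext => n; rewrite /frame_form_term innerZl -mulrA.
rewrite -[RHS]/(c * Re ('[f, f_ n] * '[f_ n, g])).
by case: ('[f, f_ n] * _) => a b /=; rewrite mul0r subr0.
Qed.

Lemma frame_form_termi f g :
  frame_form_term ('i%C *: f) g = - frame_form_term f ('i%C *: g).
Proof.
apply/funext => n.
rewrite -[RHS]/(- Re ('[f, f_ n] * '[f_ n, 'i%C *: g])) /frame_form_term.
rewrite innerZl innerZr.
by case: '[f, f_ n] => a b; case: '[f_ n, g] => c d /=; ring.
Qed.

Lemma frame_form_term_Im f g n :
  Im ('[f, f_ n] * '[f_ n, g]) = - frame_form_term ('i%C *: f) g n.
Proof.
by rewrite /frame_form_term innerZl -mulrA [in RHS]mulrC ReiNIm opprK.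
Qed.

Hypothesis f_bessel : forall f, csummable (frame_term f_ f).

Lemma frame_form_cvg f g : cvgn (series (frame_form_term f g)).
Proof.
(* polarization: only the diagonal terms are known to be summable *)
have diag h : cvgn (series (frame_form_term h h)).
  have [hRe _] := csum_ReIm _ (f_bessel h); apply/cvg_ex.
  by exists (Re (csum (frame_term f_ h))); rewrite -Re_frame_term.
have -> : frame_form_term f g = (2^-1 : R) *: (frame_form_term (f + g) (f + g)
    - frame_form_term f f - frame_form_term g g).
  rewrite frame_form_termD ![frame_form_term _ (f + g)]frame_form_termC.
  rewrite !frame_form_termD [frame_form_term g f]frame_form_termC.
  apply/funext => n.
  rewrite -[RHS]/(2^-1 * (_ + _ + (_ + _) - _ - _)).
  by field.
apply: is_cvg_seriesZ.
exact: is_cvg_seriesB (is_cvg_seriesB (diag _) (diag _)) (diag _).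
Qed.

Lemma frame_form_psd : psd_form frame_form.
Proof.
split=> [f g|f g h|c f g|f]; rewrite /frame_form.
- by rewrite frame_form_termC.
- by rewrite frame_form_termD lim_seriesD //; exact: frame_form_cvg.
- by rewrite frame_form_termZ lim_seriesZ //; exact: frame_form_cvg.
- apply: limr_ge; first exact: frame_form_cvg.
  apply: nearW => n; apply: sumr_ge0 => k _.
  by rewrite -ler0c -frame_termE exprn_ge0.
Qed.

Lemma frame_formi f g : frame_form ('i%C *: f) g = - frame_form f ('i%C *: g).
Proof.
by rewrite /frame_form frame_form_termi lim_seriesN //; exact: frame_form_cvg.
Qed.

Lemma Re_csum_frame f : Re (csum (frame_term f_ f)) = frame_form f f.
Proof.
have [hRe _] := csum_ReIm _ (f_bessel f).
by rewrite -(cvg_lim _ hRe) // Re_frame_term.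
Qed.

(** The controlled sum at [f] is the Hermitian frame form at [f] and [C f]. *)
Lemma csum_controlled (C : H -> H) f : (forall x y, '[C x, y] = '[x, C y]) ->
  csummable (controlled_term C f_ f) ->
  Re (csum (controlled_term C f_ f)) = frame_form f (C f) /\
  Im (csum (controlled_term C f_ f)) = - frame_form ('i%C *: f) (C f).
Proof.
move=> symC /csum_ReIm[hRe hIm].
have E : controlled_term C f_ f = fun n => '[f, f_ n] * '[f_ n, C f].
  by apply/funext => n; rewrite /controlled_term symC.
split.
  by rewrite -(cvg_lim _ hRe) // E.
rewrite -(cvg_lim _ hIm) // E /frame_form -lim_seriesN; last first.
  exact: frame_form_cvg.
by congr (limn (series _)); apply/funext => n; rewrite frame_form_term_Im.
Qed.

End FrameForm.

Theorem proposition3p7 (R : realType) (H : hilbertType R)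
    (H_separable : separable_space H)
    (K : H -> H) (K_bounded : bounded_op K) (K_closed : closed (range K))
    (C : H -> H) (C_GLpos : GLpos C) (CK_comm : C \o K = K \o C)
    (f_ : nat -> H) :
  controlled_K_frame C K f_ -> K_frame K f_.
Proof.
case=> -[B B_gt0 bessel] [A [B' [A_gt0 controlled]]].
have f_bessel f : csummable (frame_term f_ f) := proj1 (bessel f).
have [Cb Cpos [D Db [CK _]]] := C_GLpos.
have symC := positive_sym C Cb Cpos.
have [CD _ _ CZ] := linear_opE _ (proj1 Cb).
(* the controlled sum is real, so [C] commutes with the frame operator *)
have form_sym : forall x y, frame_form f_ (C x) y = frame_form f_ x (C y).
  apply: polarization_sym => //.
  - exact: frame_form_psd.
  - exact: frame_formi.
  move=> x; have [cs /andP[_ le_B]] := controlled x.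
  have [_ ImE] := csum_controlled f_ f_bessel C x symC cs.
  apply/eqP; rewrite -oppr_eq0 -ImE; move: le_B.
  by rewrite norm_rnorm -rmorphXn -rmorphM lecE /= eq_sym => /andP[].
have [M M_gt0 hM] := bounded_op_rnorm _ Cb.
have form_le f : frame_form f_ f f <= B * rnorm f ^+ 2.
  have [_] := bessel f; rewrite norm_rnorm -rmorphXn -rmorphM lecE /=.
  by rewrite Re_csum_frame // => /andP[].
have form_reid f : frame_form f_ f (C f) <= M * frame_form f_ f f.
  have psd := frame_form_psd f_ f_bessel.
  rewrite -form_sym.
  apply: (@reid_inequality _ _ _ C f (B * rnorm f ^+ 2)) => //.
  move=> n; have [_ _ _ b0] := psd.
  have rhs_ge0 : 0 <= B * rnorm f ^+ 2 * M ^+ n.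
    apply: mulr_ge0 (exprn_ge0 _ (ltW M_gt0)).
    exact: mulr_ge0 (ltW B_gt0) (sqr_ge0 _).
  apply: le_trans (ler_norm _) _.
  rewrite -ler_sqr ?nnegrE // real_normK ?num_real //.
  apply: le_trans (cauchy_schwarz _ _ _ psd) _.
  have -> : (B * rnorm f ^+ 2 * M ^+ n) ^+ 2
      = B * (M ^+ n * rnorm f) ^+ 2 * (B * rnorm f ^+ 2) by ring.
  apply: ler_pM; rewrite ?b0 // (le_trans (form_le _)) // ler_pM2l //.
  rewrite ler_sqr ?nnegrE ?mulr_ge0 ?exprn_ge0 ?rnorm_ge0 // ?(ltW M_gt0) //.
  exact: rnorm_iter_le _ (ltW M_gt0) hM.
(* the chosen square root is a genuine one *)
have [S_b _ SS] : [/\ bounded_op (sqrt_op C), positive_op (sqrt_op C) &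
    sqrt_op C \o sqrt_op C = C].
  exact: (getPex (GLpos_sqrt_exists C C_GLpos)).
have [m m_gt0 hm] := bounded_op_rnorm _ Db.
have [N N_gt0 hN] := bounded_op_rnorm _ S_b.
(* [sqrt_op C] is bounded below because [C] is and [sqrt_op C] is bounded *)
have lower h : rnorm h <= m * N * rnorm (sqrt_op C h).
  have /= SSh := congr1 (fun T : H -> H => T h) SS.
  have := hm (C h); rewrite CK -SSh => /le_trans; apply.
  by rewrite -mulrA ler_pM2l.
exists (A / (M * (m * N) ^+ 2)), B; split => //.
  by rewrite divr_gt0 ?mulr_gt0 ?exprn_gt0 ?mulr_gt0.
move=> f; have [cs_f le_B] := bessel f; split => //; rewrite le_B andbT.
have [cs /andP[le_A _]] := controlled f.
have [ReE _] := csum_controlled f_ f_bessel C f symC cs.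
move: le_A le_B; rewrite !norm_rnorm -!rmorphXn -!rmorphM !lecE /= ReE.
move=> /andP[_ le_A] /andP[Im0 _].
rewrite eq_sym Im0 /= Re_csum_frame //.
rewrite mulrAC ler_pdivrMr ?mulr_gt0 ?exprn_gt0 ?mulr_gt0 //.
set h := adjoint K f.
have h2 : rnorm h ^+ 2 <= (m * N) ^+ 2 * rnorm (sqrt_op C h) ^+ 2.
  rewrite -exprMn; apply: lerXn2r (lower h); rewrite nnegrE ?rnorm_ge0 //.
  by rewrite (le_trans _ (lower h)) ?rnorm_ge0.
apply: (@le_trans _ _ ((m * N) ^+ 2 * (A * rnorm (sqrt_op C h) ^+ 2))).
  by rewrite [leRHS]mulrCA ler_pM2l.
apply: (@le_trans _ _ ((m * N) ^+ 2 * (M * frame_form f_ f f))).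
  by rewrite ler_pM2l ?exprn_gt0 ?mulr_gt0 // (le_trans le_A) // form_reid.
by rewrite le_eqVlt; apply/orP; left; apply/eqP; ring.
Qed.
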